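(* Let $P$ be a naturally labeled poset on $\{1,\ldots,n\}$ and let $C_1,\ldots,C_h$ be the connected components of the graph $G_P$. Let $1\le r\le h$ and let $M_r$ be a maximum independent set of $C_r$. Then for any two maximum independent sets $M^1,M^2$ of $G_P$ with $M^1\cap V(C_r)=M^2\cap V(C_r)=M_r$, we have $\mathrm{Des}(M_r,M^1)=\mathrm{Des}(M_r,M^2)$ and $\overline{\mathrm{Des}}(M_r,M^1)=\overline{\mathrm{Des}}(M_r,M^2)$.
   Context: $P$ is a partial order $\leq_P$ on $[n]=\{1,\ldots,n\}$; it is naturally labeled if $i<_P j$ implies $i<j$. An order ideal is a subset $J$ with $i\in J$, $j\leq_P i\Rightarrow j\in J$; a nonempty order ideal is connected if the Hasse diagram of $P$ restricted to it is connected. Sets $A,B$ intersect nontrivially if $A\cap B\ne\emptyset$, $A\not\subseteq B$, $B\not\subseteq A$. $G_P$ is the simple graph whose vertices are the connected order ideals of $P$, adjacent iff they intersect nontrivially; $V(C)$ denotes the vertex set of a subgraph $C$. A maximum independent set is an independent set (pairwise non-adjacent vertices) of largest possible size. For a maximum independent set $M$ of $G_P$ and $J\in M$ let $\mu(M,J)=\bigcup_{J'\in M,\,J'\subsetneq J}J'$. It is a fact (established in the paper) that for each $J\in M$, $J\setminus\mu(M,J)$ is a single element and distinct $J\in M$ give distinct elements, so each $i\in[n]$ corresponds to a unique $J_i\in M$ with $J_i\setminus\mu(M,J_i)=\{i\}$. Let $F_M$ be the poset on $[n]$ with $i<_{F_M}j$ iff $J_i\subsetneq J_j$; it is a forest (each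 element covered by at most one element, called its parent). For a forest $F$ on $[n]$, $\mathrm{Des}(F)=\{i : \text{the parent } j \text{ of } i \text{ satisfies } i>j\}$. Set $\mathrm{Des}(M)=\mathrm{Des}(F_M)$. For a maximum independent set $M_r$ of $C_r$ and a maximum independent set $M$ of $G_P$ with $M\cap V(C_r)=M_r$, define $\mathrm{Des}(M_r,M)=\{i\in\mathrm{Des}(M) : \{i\}=J\setminus\mu(M,J)\text{ for some }J\in M_r\}$ and $\overline{\mathrm{Des}}(M_r,M)=\{J\in M_r : J\setminus\mu(M,J)=\{i\}\text{ for some } i\in\mathrm{Des}(M_r,M)\}$. *)

(* Defs.v *)
From mathcomp Require Import all_boot.

Set Implicit Arguments.
Unset Strict Implicit.
Unset Printing Implicit Defensive.

(** The ground set [n] = {1, ..., n} is represented by 'I_n, the label k being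
    the ordinal k - 1; only comparisons between labels matter below. *)

Section SimpleGraphs.

Variable T : finType.

Record sgraph := SGraph {
  vert : {set T};
  edge : rel T;
  edge_sym : symmetric edge;
  edge_irr : irreflexive edge;
  edge_vert : forall x y, edge x y -> x \in vert
}.

Definition induced_edge (A : {set T}) (e : rel T) : rel T :=
  fun x y => [&& x \in A, y \in A & e x y].

Lemma induced_edge_sym A e : symmetric e -> symmetric (induced_edge A e).
Proof. by move=> es x y; rewrite /induced_edge es andbCA. Qed.

Lemma induced_edge_irr A e : irreflexive e -> irreflexive (induced_edge A e).
Proof. by move=> ei x; rewrite /induced_edge ei !andbF. Qed.

Lemma induced_edge_vert A e x y : induced_edge A e x y -> x \in A.
Proof. by case/and3P. Qed.

Definition mk_sgraph (A : {set T}) (e : rel T)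
    (es : symmetric e) (ei : irreflexive e) : sgraph :=
  SGraph (@induced_edge_sym A e es) (@induced_edge_irr A e ei)
         (@induced_edge_vert A e).

Definition induced (G : sgraph) (A : {set T}) : sgraph :=
  mk_sgraph (vert G :&: A) (@edge_sym G) (@edge_irr G).

Definition connected (G : sgraph) : bool :=
  (vert G != set0) &&
  [forall x in vert G, forall y in vert G, connect (edge G) x y].

Definition component_sets (G : sgraph) : {set {set T}} :=
  equivalence_partition (connect (edge G)) (vert G).

Definition independent (G : sgraph) (S : {set T}) : Prop :=
  S \subset vert G /\ {in S &, forall x y, ~~ edge G x y}.

Definition maximum_independent (G : sgraph) (S : {set T}) : Prop :=
  independent G S /\ forall S', independent G S' -> #|S'| <= #|S|.

End SimpleGraphs.

Section Posets.

Variable n : nat.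

Definition partial_order (le : rel 'I_n) : Prop :=
  [/\ reflexive le, antisymmetric le & transitive le].

Definition strict (le : rel 'I_n) : rel 'I_n :=
  fun i j => (i != j) && le i j.

Definition naturally_labeled (le : rel 'I_n) : Prop :=
  forall i j : 'I_n, strict le i j -> i < j.

Definition covered_by (lt : rel 'I_n) : rel 'I_n :=
  fun i j => lt i j && ~~ [exists k, lt i k && lt k j].

Definition hasse_edge (le : rel 'I_n) : rel 'I_n :=
  fun i j => covered_by (strict le) i j || covered_by (strict le) j i.

Lemma hasse_edge_sym le : symmetric (hasse_edge le).
Proof. by move=> i j; rewrite /hasse_edge orbC. Qed.

Lemma hasse_edge_irr le : irreflexive (hasse_edge le).
Proof. by move=> i; rewrite /hasse_edge /covered_by /strict eqxx. Qed.

Definition hasse (le : rel 'I_n) : sgraph 'I_n :=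
  mk_sgraph setT (@hasse_edge_sym le) (@hasse_edge_irr le).

Definition order_ideal (le : rel 'I_n) (J : {set 'I_n}) : bool :=
  [forall i in J, forall j, le j i ==> (j \in J)].

Definition connected_ideals (le : rel 'I_n) : {set {set 'I_n}} :=
  [set J | order_ideal le J && connected (induced (hasse le) J)].

Definition meet_nontrivially : rel {set 'I_n} :=
  fun A B => [&& A :&: B != set0, ~~ (A \subset B) & ~~ (B \subset A)].

Lemma meet_nontrivially_sym : symmetric meet_nontrivially.
Proof. by move=> A B; rewrite /meet_nontrivially setIC; congr andb; rewrite andbC. Qed.

Lemma meet_nontrivially_irr : irreflexive meet_nontrivially.
Proof. by move=> A; rewrite /meet_nontrivially subxx andbF. Qed.

Definition ideal_graph (le : rel 'I_n) : sgraph {set 'I_n} :=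
  mk_sgraph (connected_ideals le) meet_nontrivially_sym meet_nontrivially_irr.

Implicit Types (M Mr : {set {set 'I_n}}) (J : {set 'I_n}).

Definition mu M J : {set 'I_n} := \bigcup_(J' in M | J' \proper J) J'.

(** The ideal J_i of M. When M is a maximum independent set of the ideal graph
    exactly one J in M qualifies, so the default value set0 is never used. *)
Definition ideal_of M (i : 'I_n) : {set 'I_n} :=
  odflt set0 [pick J in M | J :\: mu M J == [set i]].

Definition forest_lt M : rel 'I_n :=
  fun i j => ideal_of M i \proper ideal_of M j.

(** The parent of i in a forest is the element covering i. *)
Definition forest_Des (lt : rel 'I_n) : {set 'I_n} :=
  [set i : 'I_n | [exists j : 'I_n, covered_by lt i j && (j < i)]].

Definition Des M : {set 'I_n} := forest_Des (forest_lt M).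

Definition Des_rel Mr M : {set 'I_n} :=
  [set i in Des M | [exists J in Mr, [set i] == J :\: mu M J]].

Definition Desbar_rel Mr M : {set {set 'I_n}} :=
  [set J in Mr | [exists i in Des_rel Mr M, J :\: mu M J == [set i]]].

End Posets.

(* Main.v *)
(** Call a connected ideal isolated when it has no neighbour in the ideal graph;
    isolated ideals belong to every maximum independent set. If [A] is contained
    in a vertex [B] of another component, then so is every vertex of the
    component of [A]; hence the union of the vertices of a component is an
    isolated connected ideal.

    Let [J] in [M] carry the label [i], that is, [J :\: mu M J = [set i]]. If
    [J] is isolated and its parent carries the label [j], connectedness puts [j]
    above some element of [J], and isolation puts the whole of [J] below [j]; as
    the labeling is natural, [i] is not a descent.

    If [J] is not isolated, let [U] be the union of its component. For [K = U]
    or [K] in the component, a member of [M] strictly inside [K] is either in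
    the component or contained in the union of its own component, which is
    isolated and strictly inside [K]. Hence [mu M K] depends only on the trace
    of [M] on the component. The parent of [J] is again in the component or
    equal to [U], so whether [i] is a descent depends only on the trace too. *)
Require Import Defs.
From mathcomp Require Import all_boot.

Set Implicit Arguments.
Unset Strict Implicit.
Unset Printing Implicit Defensive.

Lemma leq_sum_card_disjoint (I T : finType) (S : {set I}) (D : I -> {set T}) :
  {in S &, forall i j x, x \in D i -> x \in D j -> i = j} ->
  \sum_(i in S) #|D i| <= #|T|.
Proof.
move=> disjD; under eq_bigr do rewrite -sum1_card.
rewrite (exchange_big_dep xpredT) //= -sum1_card; apply: leq_sum => x _.
rewrite sum1dep_card; apply/card_le1_eqP => i j.
by rewrite !inE => /andP[iS xi] /andP[jS xj]; apply: disjD xj xi.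
Qed.

(** * Components and isolated vertices *)

Section Graphs.

Variables (T : finType) (G : sgraph T).

Definition component x : {set T} := [set y | connect (edge G) x y].

Definition isolated : {set T} := [set x in vert G | [forall y, ~~ edge G x y]].

Lemma component_refl x : x \in component x.
Proof. by rewrite inE. Qed.

Lemma component_eq x y : y \in component x -> component y = component x.
Proof.
rewrite inE => xy; apply/setP => z; rewrite !inE.
by rewrite (same_connect (sym_connect_sym (@edge_sym _ G)) xy).
Qed.

Lemma component_sym x y : (y \in component x) = (x \in component y).
Proof. by apply/idP/idP => /component_eq ->; apply: component_refl. Qed.

Lemma component_edge x y z :
  y \in component x -> edge G y z -> z \in component x.
Proof. by rewrite !inE => xy /connect1; apply: connect_trans. Qed.

Lemma component_ind (P : pred T) x : P x ->
    (forall y z, y \in component x -> edge G y z -> P y -> P z) ->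
  {in component x, forall y, P y}.
Proof.
move=> Px P_edge y; rewrite inE => /connectP[p + ->] {y}.
elim/last_ind: p => //= p z IHp; rewrite rcons_path last_rcons => /andP[pth yz].
by apply: P_edge yz (IHp pth); rewrite inE; apply/connectP; exists p.
Qed.

Lemma component_vert x : x \in vert G -> {subset component x <= vert G}.
Proof.
move=> xG; apply: component_ind => // y z _; rewrite edge_sym => zy _.
exact: edge_vert zy.
Qed.

Lemma component_setsE C x :
  C \in component_sets G -> x \in C -> C = component x.
Proof.
case/imsetP=> y yG -> /setIdP[xG yx]; rewrite (@component_eq y) ?inE //.
apply/setP => z; rewrite !inE andbC; case: (boolP (connect _ _ _)) => //= yz.
by apply: component_vert yG _ _; rewrite inE.
Qed.

Lemma isolated_component x : x \in isolated -> component x = [set x].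
Proof.
case/setIdP=> _ /forallP no_edge; apply/eqP.
rewrite eqEsubset sub1set component_refl andbT; apply/subsetP.
apply: component_ind => [|y z _ + /set1P eyx].
  by rewrite inE.
by rewrite eyx (negPf (no_edge z)).
Qed.

Lemma component_not_isolated x y :
  x \notin isolated -> y \in component x -> y \notin isolated.
Proof.
move=> nx; rewrite component_sym; apply: contraL => y_iso.
by rewrite (isolated_component y_iso) inE; apply: contraNneq nx => ->.
Qed.

Lemma isolated_sub_maximum M : maximum_independent G M -> isolated \subset M.
Proof.
case=> [[sM indM] maxM]; apply/subsetP => x /setIdP[xG /forallP no_edge].
apply/negPn/negP => xM.
suff /maxM : independent G (x |: M) by rewrite cardsU1 xM ltnn.
split; first by rewrite subUset sub1set xG.
move=> y z /setU1P[->|yM] /setU1P[->|zM] //; last exact: indM.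
by rewrite edge_sym.
Qed.

End Graphs.

(** * Labels, children and descents of a family of sets *)

Section Children.

Variable n : nat.

Implicit Types (i j x : 'I_n) (A B J K : {set 'I_n}) (M : {set {set 'I_n}}).

Definition labeled M J i : bool := (J \in M) && (J :\: mu M J == [set i]).

Definition child M A B : bool :=
  [&& A \in M, B \in M, A \proper B &
      [forall L in M, (A \proper L) ==> ~~ (L \proper B)]].

Definition descent M J i : bool :=
  labeled M J i &&
  [exists K, exists j : 'I_n, [&& child M J K, labeled M K j & j < i]].

Lemma mem_mu M J x :
  reflect (exists2 A, (A \in M) && (A \proper J) & x \in A) (x \in mu M J).
Proof. exact: bigcupP. Qed.

Lemma sub_mu M A J : A \in M -> A \proper J -> A \subset mu M J.
Proof. by move=> AM AJ; apply: bigcup_sup; rewrite AM. Qed.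

Lemma childP M A B :
  reflect [/\ A \in M, B \in M, A \proper B &
              forall L, L \in M -> A \proper L -> ~~ (L \proper B)]
          (child M A B).
Proof.
apply: (iffP and4P) => -[AM BM pAB nobetween]; split=> //.
  by move=> L LM; apply/implyP; apply: (forall_inP nobetween).
by apply/forall_inP => L LM; apply/implyP; apply: nobetween.
Qed.

Lemma descentP M J i :
  reflect (labeled M J i /\
           exists K j, [/\ child M J K, labeled M K j & j < i])
          (descent M J i).
Proof.
apply: (iffP andP) => -[Ji].
  by case/existsP=> K /existsP[j /and3P[]]; split=> //; exists K, j.
case=> K [j [JK Kj ji]]; split=> //.
by apply/existsP; exists K; apply/existsP; exists j; rewrite JK Kj.
Qed.

Lemma child_exists M J : J \in M -> mu M J != set0 -> exists A, child M A J.
Proof.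
move=> JM /set0Pn[x /mem_mu[A0 A0P _]].
pose inside A := (A \in M) && (A \proper J).
case: (@arg_maxnP _ A0 inside (fun A => #|A|) A0P) => A /andP[AM pAJ] maxA.
exists A; apply/childP; split=> // L LM pAL.
apply/negP => pLJ; have := maxA L; rewrite /inside LM pLJ => /(_ isT).
by rewrite /= leqNgt (proper_card pAL).
Qed.

End Children.

(** * Connected order ideals *)

Section ConnectedIdeals.

Variables (n : nat) (le : rel 'I_n).
Hypothesis le_po : partial_order le.

Implicit Types (i j k x : 'I_n) (A B E F J K : {set 'I_n}).
Implicit Types (S M Mr : {set {set 'I_n}}).

Local Notation V := (connected_ideals le).
Local Notation G := (ideal_graph le).

Let le_refl : reflexive le. Proof. by case: le_po. Qed.
Let le_anti : antisymmetric le. Proof. by case: le_po. Qed.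
Let le_trans : transitive le. Proof. by case: le_po. Qed.

Lemma order_idealP J :
  reflect (forall i j, i \in J -> le j i -> j \in J) (order_ideal le J).
Proof.
apply: (iffP forall_inP) => [idJ i j iJ | idJ i iJ].
  by move/forallP/(_ j)/implyP: (idJ i iJ).
by apply/forallP => j; apply/implyP; apply: idJ.
Qed.

Lemma induced_hasse_edgeE J i j :
  edge (induced (hasse le) J) i j = [&& i \in J, j \in J & hasse_edge le i j].
Proof. by rewrite /= /induced_edge !inE. Qed.

Lemma le_connect_hasse J i j : order_ideal le J -> j \in J -> le i j ->
  connect (edge (induced (hasse le) J)) i j.
Proof.
move/order_idealP=> idJ; pose interval a b := [set c | le a c && le c b].
have [m] := ubnP #|interval i j|; elim: m i j => // m IH i j.
rewrite ltnS => le_m jJ ij.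
have [->|neq_ij] := eqVneq i j; first exact: connect0.
have [/existsP[k]|nobetween] :=
  boolP [exists k, strict le i k && strict le k j]; last first.
  apply: connect1; rewrite induced_hasse_edgeE jJ (idJ j) //=.
  by rewrite /hasse_edge /covered_by nobetween /strict neq_ij ij.
case/andP=> /andP[neq_ik ik] /andP[neq_kj kj].
have shorter a b x : le i a -> le b j ->
    x \in interval i j -> x \notin interval a b -> #|interval a b| < m.
  move=> ia bj xij xab; apply: leq_trans (proper_card _) le_m.
  apply/properP; split; last by exists x.
  apply/subsetP => c; rewrite !inE => /andP[ac cb].
  by rewrite (le_trans ia ac) (le_trans cb bj).
apply: (@connect_trans _ _ k).
  apply: IH (idJ _ _ jJ kj) ik; apply: (@shorter _ _ j) => //.
    by rewrite inE ij le_refl.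
  rewrite inE ij /=.
  by apply: contraNN neq_kj => jk; apply/eqP/le_anti; rewrite kj.
apply: IH jJ kj; apply: (@shorter _ _ i) => //; first by rewrite inE ij le_refl.
rewrite inE ij andbT.
by apply: contraNN neq_ik => ki; apply/eqP/le_anti; rewrite ik.
Qed.

Definition comparability_closed J K : Prop :=
  {in J &, forall i j, le i j -> (i \in K) = (j \in K)}.

Lemma connected_idealsP J :
  J \in V <->
  [/\ order_ideal le J, J != set0 &
      forall K x, comparability_closed J K -> x \in J -> x \in K ->
        J \subset K].
Proof.
rewrite inE /connected.
have -> : vert (induced (hasse le) J) = J := setTI J.
set e := edge _.
have e_sym : connect_sym e by apply: sym_connect_sym; apply: edge_sym.
split=> [/and3P[idJ J0 /forall_inP conJ] | [idJ J0 closed_subJ]].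
  split=> // K x K_closed xJ xK; apply/subsetP => y yJ.
  have e_closed : closed e K.
    move=> a b; rewrite [e a b]induced_hasse_edgeE => /and3P[aJ bJ].
    by case/orP=> /andP[/andP[_ ab] _]; rewrite (K_closed _ _ _ _ ab).
  by have /forall_inP/(_ y yJ)/(closed_connect e_closed) <- := conJ x xJ.
rewrite idJ J0; apply/forall_inP => x xJ; apply/forall_inP => y yJ.
suff /subsetP/(_ y yJ) : J \subset [set z | connect e x z] by rewrite inE.
apply: (closed_subJ _ x) => //; last by rewrite inE.
move=> i j _ jJ ij; rewrite !inE.
by apply: same_connect_r; [exact: e_sym | exact: le_connect_hasse].
Qed.

Lemma connected_ideal_le J i j : J \in V -> i \in J -> le j i -> j \in J.
Proof. by case/connected_idealsP => /order_idealP idJ _ _; apply: idJ. Qed.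

Lemma connected_ideal_inhabited J : J \in V -> exists i, i \in J.
Proof. by case/connected_idealsP => _ /set0Pn. Qed.

Lemma connected_ideal_sub J K x : J \in V -> comparability_closed J K ->
  x \in J -> x \in K -> J \subset K.
Proof. by case/connected_idealsP => _ _; apply. Qed.

Lemma principal_ideal_connected j : [set i | le i j] \in V.
Proof.
apply/connected_idealsP; split.
- by apply/order_idealP => a b; rewrite !inE => aj ba; apply: le_trans ba aj.
- by apply/set0Pn; exists j; rewrite inE.
move=> K x K_closed xj xK; have jj : j \in [set i | le i j] by rewrite inE.
have jK : j \in K by rewrite -(K_closed x) //; rewrite inE in xj.
by apply/subsetP => i ij; rewrite (K_closed i j) //; rewrite inE in ij.
Qed.

Definition intersect : rel {set 'I_n} := fun A B => A :&: B != set0.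

Lemma cover_connected S : S \subset V -> S != set0 ->
    {in S &, forall A B, connect (induced_edge S intersect) A B} ->
  cover S \in V.
Proof.
move=> /subsetP sSV /set0Pn[E ES] conS; apply/connected_idealsP; split.
- apply/order_idealP => i j /bigcupP[A AS iA] ji; apply/bigcupP; exists A => //.
  exact: connected_ideal_le (sSV A AS) iA ji.
- have [x xE] := connected_ideal_inhabited (sSV E ES).
  by apply/set0Pn; exists x; apply/bigcupP; exists E.
move=> K x K_closed /bigcupP[A AS xA] xK.
have member_subK B y : B \in S -> y \in B -> y \in K -> B \subset K.
  move=> BS; apply: connected_ideal_sub (sSV B BS) _ => i j iB jB.
  by apply: K_closed; apply/bigcupP; exists B.
have sub_closed : closed (induced_edge S intersect)
                         [pred B : {set 'I_n} | B \subset K].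
  apply: intro_closed => [|B F /and3P[_ FS]].
    by apply/sym_connect_sym/induced_edge_sym => B F; rewrite /intersect setIC.
  case/set0Pn=> y /setIP[yB yF] /subsetP sBK.
  exact: member_subK FS yF (sBK y yB).
apply/bigcupsP => B BS; have := closed_connect sub_closed (conS A B AS BS).
by rewrite !inE (member_subK A x) // => <-.
Qed.

Lemma cover_connected_point S x : S \subset V -> S != set0 ->
  {in S, forall A, x \in A} -> cover S \in V.
Proof.
move=> sSV S0 xS; apply: cover_connected => // A B AS BS; apply: connect1.
by rewrite /induced_edge AS BS; apply/set0Pn; exists x; rewrite inE !xS.
Qed.

Lemma setU_connected A B x : A \in V -> B \in V -> x \in A -> x \in B ->
  A :|: B \in V.
Proof.
move=> AV BV xA xB.
have -> : A :|: B = cover [set A; B] by rewrite /cover bigcup_setU !big_set1.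
apply: (@cover_connected_point _ x).
- by rewrite subUset !sub1set AV.
- by apply/set0Pn; exists A; rewrite set21.
by move=> E /set2P[] ->.
Qed.

Lemma nonadjacent_nested A B x : A \in V -> B \in V -> ~~ edge G A B ->
  x \in A -> x \in B -> A \subset B \/ B \subset A.
Proof.
move=> AV BV + xA xB; rewrite /= /induced_edge AV BV /meet_nontrivially /=.
have -> /= : A :&: B != set0 by apply/set0Pn; exists x; rewrite inE xA.
by rewrite negb_and !negbK => /orP.
Qed.

Lemma isolated_nested J B x : J \in isolated G -> B \in V ->
  x \in J -> x \in B -> J \subset B \/ B \subset J.
Proof. by case/setIdP=> JV /forallP nJ BV; apply: nonadjacent_nested. Qed.

Lemma component_outside_nested E F B x : E \in V -> F \in component G E ->
    B \in V -> B \notin component G E -> x \in F -> x \in B ->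
  F \subset B \/ B \subset F.
Proof.
move=> EV EF BV nEB; apply: nonadjacent_nested; first exact: component_vert EF.
  by [].
by apply: contra nEB; apply: component_edge.
Qed.

Lemma cover_component_sub E B : E \in V -> B \in V ->
  B \notin component G E -> E \subset B -> cover (component G E) \subset B.
Proof.
move=> EV BV nEB sEB; apply/bigcupsP; apply: component_ind => // F H EF FH sFB.
have EH := component_edge EF FH.
case/and3P: FH => _ _ /and3P[/set0Pn[x /setIP[xF xH]] nFH _].
case: (component_outside_nested EV EH BV nEB xH (subsetP sFB x xF)) => // sBH.
by rewrite (subset_trans sFB sBH) in nFH.
Qed.

Lemma sub_cover_component E F :
  F \in component G E -> F \subset cover (component G E).
Proof. exact: bigcup_sup. Qed.

Lemma cover_component_connected E : E \in V -> cover (component G E) \in V.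
Proof.
move=> EV; apply: cover_connected.
- by apply/subsetP; apply: component_vert.
- by apply/set0Pn; exists E; apply: component_refl.
move=> A B EA; rewrite -(component_eq EA).
apply: component_ind => // F H AF FH AconF.
apply: connect_trans AconF (connect1 _).
rewrite /induced_edge AF (component_edge AF FH) /=.
by case/and3P: FH => _ _ /and3P[].
Qed.

Lemma cover_component_isolated E :
  E \in V -> cover (component G E) \in isolated G.
Proof.
move=> EV; rewrite inE cover_component_connected //=; apply/forallP => B.
apply/negP => /and3P[_ BV /and3P[/set0Pn[x /setIP[xU xB]] nUB nBU]].
have [F EF xF] := bigcupP xU.
have nEB : B \notin component G E.
  by apply: contra nBU; apply: sub_cover_component.
case: (component_outside_nested EV EF BV nEB xF xB) => [sFB|sBF].
  case/negP: nUB; rewrite -(component_eq EF) cover_component_sub //.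
    exact: component_vert EF.
  by rewrite (component_eq EF).
by rewrite (subset_trans sBF (sub_cover_component EF)) in nBU.
Qed.

(** * Independent and maximum independent sets *)

Section IndependentSet.

Variable M : {set {set 'I_n}}.
Hypothesis M_ind : independent G M.

Lemma independent_connected J : J \in M -> J \in V.
Proof. by case: M_ind => /subsetP sMV _; apply: sMV. Qed.

Lemma independent_nested A B x : A \in M -> B \in M -> x \in A -> x \in B ->
  A \subset B \/ B \subset A.
Proof.
case: (M_ind) => _ ind AM BM.
by apply: nonadjacent_nested (ind A B AM BM); apply: independent_connected.
Qed.

Lemma setD_mu_disjoint A B x : A \in M -> B \in M ->
  x \in A :\: mu M A -> x \in B :\: mu M B -> A = B.
Proof.
move=> AM BM /setDP[xA xnA] /setDP[xB xnB].
case: (independent_nested AM BM xA xB); rewrite subEproper => /predU1P[//|prop].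
  by rewrite (subsetP (sub_mu AM prop)) in xnB.
by rewrite (subsetP (sub_mu BM prop)) in xnA.
Qed.

Lemma labeled_unique A B i : labeled M A i -> labeled M B i -> A = B.
Proof.
case/andP=> AM /eqP Ai /andP[BM /eqP Bi].
by apply: (@setD_mu_disjoint A B i); rewrite // ?Ai ?Bi inE.
Qed.

(** Otherwise [A] would be comparability-closed in the connected ideal [J]. *)
Lemma child_below_setD_mu A J : child M A J ->
  exists i j, [/\ i \in A, j \in J :\: mu M J & le i j].
Proof.
case/childP=> AM JM pAJ maxA.
have [AV JV] := (independent_connected AM, independent_connected JM).
have [/exists_inP[i iA /exists_inP[j jJ ij]]|none] :=
  boolP [exists i in A, exists j in J :\: mu M J, le i j]; first by exists i, j.
have A_closed : comparability_closed J A.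
  move=> i j _ jJ ij; apply/idP/idP => [iA|jA]; last first.
    exact: connected_ideal_le jA ij.
  apply: contraNT none => jnA; apply/exists_inP; exists i => //.
  apply/exists_inP; exists j; rewrite // inE jJ andbT.
  apply/negP => /mem_mu[B /andP[BM pBJ] jB].
  have iB := connected_ideal_le (independent_connected BM) jB ij.
  case: (independent_nested AM BM iA iB) => [sAB|/subsetP/(_ j jB)].
    have pAB : A \proper B by apply/properP; split=> //; exists j.
    by have := maxA B BM pAB; rewrite pBJ.
  by rewrite (negPf jnA).
have [x xA] := connected_ideal_inhabited AV.
have := connected_ideal_sub JV A_closed (subsetP (proper_sub pAJ) x xA) xA.
by move: pAJ; rewrite properE => /andP[_ /negPf->].
Qed.

Lemma setD_mu_neq0 J : J \in M -> J :\: mu M J != set0.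
Proof.
move=> JM; have [mu0|/(child_exists JM)[A]] := eqVneq (mu M J) set0.
  rewrite mu0 setD0; apply/set0Pn.
  exact: connected_ideal_inhabited (independent_connected JM).
by case/child_below_setD_mu=> _ [j [_ jJ _]]; apply/set0Pn; exists j.
Qed.

End IndependentSet.

Hypothesis le_nat : naturally_labeled le.

Lemma le_natural i j : le i j -> i <= j.
Proof.
move=> ij; have [->//|neq_ij] := eqVneq i j.
by apply/ltnW/le_nat; rewrite /strict neq_ij.
Qed.

Lemma isolated_not_descent M J i :
  independent G M -> J \in isolated G -> ~~ descent M J i.
Proof.
move=> M_ind J_iso; apply/descentP=> -[/andP[_ /eqP Ji] [K [j [JK Kj ji]]]].
have [k [u [kJ + ku]]] := child_below_setD_mu M_ind JK.
case/andP: Kj => _ /eqP Kj; rewrite Kj => /set1P eu; rewrite {u}eu in ku.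
have kj : k \in [set x | le x j] by rewrite inE.
case: (isolated_nested J_iso (principal_ideal_connected j) kJ kj) => /subsetP.
  have /setDP[iJ _] : i \in J :\: mu M J by rewrite Ji set11.
  by move/(_ i iJ); rewrite inE => /le_natural; rewrite leqNgt ji.
have /setDP[_ jmu] : j \in K :\: mu M K by rewrite Kj set11.
move/(_ j); rewrite inE le_refl => /(_ isT) jJ.
by case/childP: JK => JM _ pJK _; rewrite (subsetP (sub_mu JM pJK)) in jmu.
Qed.

Definition ideals_topped_by i : {set {set 'I_n}} :=
  [set J in V | (i \in J) && (J \subset [set k : 'I_n | k <= i])].

(** The connected component of [i] in the Hasse diagram of [{k | k <= i}]. *)
Definition prefix_component i : {set 'I_n} := cover (ideals_topped_by i).

Lemma prefix_component_topped i : prefix_component i \in ideals_topped_by i.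
Proof.
have iP : [set j | le j i] \in ideals_topped_by i.
  rewrite inE principal_ideal_connected inE le_refl /=.
  by apply/subsetP => j; rewrite !inE; apply: le_natural.
rewrite inE; apply/and3P; split.
- apply: (@cover_connected_point _ i).
  + by apply/subsetP => J /setIdP[].
  + by apply/set0Pn; exists [set j | le j i].
  + by move=> J /setIdP[_ /andP[]].
- by apply/bigcupP; exists [set j | le j i]; rewrite // inE.
by apply/bigcupsP => J /setIdP[_ /andP[]].
Qed.

Lemma prefix_component_max J i :
  J \in ideals_topped_by i -> J \subset prefix_component i.
Proof. exact: bigcup_sup. Qed.

Lemma prefix_component_connected i : prefix_component i \in V.
Proof. by case/setIdP: (prefix_component_topped i). Qed.

Lemma mem_prefix_component i : i \in prefix_component i.
Proof. by case/setIdP: (prefix_component_topped i) => _ /andP[]. Qed.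

Lemma prefix_component_leq i j : j \in prefix_component i -> j <= i.
Proof.
case/setIdP: (prefix_component_topped i) => _ /andP[_ /subsetP sub] /sub.
by rewrite inE.
Qed.

Lemma prefix_component_inj : injective prefix_component.
Proof.
move=> i j eq_ij; apply/val_inj/eqP; rewrite eqn_leq !prefix_component_leq //.
  by rewrite eq_ij mem_prefix_component.
by rewrite -eq_ij mem_prefix_component.
Qed.

Lemma prefix_component_nested i j x : i <= j ->
  x \in prefix_component i -> x \in prefix_component j ->
  prefix_component i \subset prefix_component j.
Proof.
move=> le_ij xi xj; apply: subset_trans (subsetUl _ (prefix_component j)) _.
apply: prefix_component_max.
rewrite inE (setU_connected _ _ xi xj) ?prefix_component_connected //.
rewrite in_setU mem_prefix_component orbT /=; apply/subsetP => k.
rewrite !inE => /orP[] /prefix_component_leq // le_ki.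
exact: leq_trans le_ki le_ij.
Qed.

Lemma independent_prefix_components : independent G (prefix_component @: setT).
Proof.
split.
  apply/subsetP => _ /imsetP[i _ ->]; exact: prefix_component_connected.
move=> _ _ /imsetP[i _ ->] /imsetP[j _ ->].
apply/negP => /and3P[_ _ /and3P[/set0Pn[x /setIP[xi xj]] nsij nsji]].
case/orP: (leq_total i j) => le_ij.
  by rewrite (prefix_component_nested le_ij xi xj) in nsij.
by rewrite (prefix_component_nested le_ij xj xi) in nsji.
Qed.

Section MaximumIndependentSet.

Variable M : {set {set 'I_n}}.
Hypothesis M_max : maximum_independent G M.

Let M_ind : independent G M. Proof. by case: M_max. Qed.

Lemma card_maximum_geq : n <= #|M|.
Proof.
case: M_max => _ /(_ _ independent_prefix_components); apply: leq_trans.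
by rewrite (card_imset _ prefix_component_inj) cardsT card_ord.
Qed.

(** The sets [J :\: mu M J] are at least [n] nonempty disjoint subsets of
    ['I_n]. *)
Lemma maximum_labeled J : J \in M -> exists i, labeled M J i.
Proof.
move=> JM; have size_gt0 A : A \in M -> 0 < #|A :\: mu M A|.
  by move=> AM; rewrite card_gt0 setD_mu_neq0.
have := leqif_sum (fun A AM => leqif_eq (size_gt0 A AM)).
move/geq_leqif; rewrite sum1_card (leq_trans _ card_maximum_geq); last first.
  rewrite -[leqRHS]card_ord; apply: leq_sum_card_disjoint => A B AM BM x.
  exact: (setD_mu_disjoint M_ind AM BM).
move/esym/forall_inP/(_ J JM); rewrite eq_sym => /cards1P[i /eqP Ji].
by exists i; rewrite /labeled JM.
Qed.

Lemma labeled_ideal_of J i : labeled M J i -> ideal_of M i = J.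
Proof.
move=> Ji; rewrite /ideal_of; case: pickP => [A Ai | /(_ J)] /=.
  exact: (labeled_unique M_ind Ai Ji).
by rewrite -/(labeled M J i) Ji.
Qed.

(** Strict containment in [ideal_of M i] excludes the default value [set0]. *)
Lemma proper_ideal_of_labeled J i :
  J \proper ideal_of M i -> labeled M (ideal_of M i) i.
Proof.
rewrite /ideal_of; case: pickP => //= _.
by rewrite properE sub0set andbF.
Qed.

Lemma covered_by_forest_lt J i j : labeled M J i ->
  covered_by (forest_lt M) i j =
  child M J (ideal_of M j) && labeled M (ideal_of M j) j.
Proof.
move=> Ji; rewrite /covered_by /forest_lt (labeled_ideal_of Ji).
apply/andP/andP => [[pJ /existsPn nobetween]|[/childP[JM KM pJ nobetween] Kj]].
  have Kj := proper_ideal_of_labeled pJ; split=> //; apply/childP.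
  case/andP: Ji Kj => JM _ /andP[KM _]; split=> // L LM pL.
  have [k Lk] := maximum_labeled LM.
  by have := nobetween k; rewrite (labeled_ideal_of Lk) pL.
split=> //; apply/existsPn => k; apply/negP => /andP[pk].
by apply/negP/nobetween => //; case/andP: (proper_ideal_of_labeled pk).
Qed.

Lemma mem_Des J i : labeled M J i -> (i \in Des M) = descent M J i.
Proof.
move=> Ji; rewrite inE; apply/existsP/descentP => [[j]|[_ [K [j [JK Kj ji]]]]].
  rewrite (covered_by_forest_lt _ Ji) => /andP[/andP[JK Kj] ji].
  by split=> //; exists (ideal_of M j), j.
by exists j; rewrite (covered_by_forest_lt _ Ji) (labeled_ideal_of Kj) JK Kj.
Qed.

Lemma Des_relE Mr : Mr \subset M ->
  Des_rel Mr M = [set i | [exists J in Mr, descent M J i]].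
Proof.
move=> /subsetP sMr; apply/setP => i; rewrite [LHS]inE [RHS]inE.
apply/andP/exists_inP => [[iD /exists_inP[J JMr Ji]]|[J JMr Ji]].
  by exists J; rewrite // -mem_Des // /labeled sMr // eq_sym.
have /descentP[labJ _] := Ji; rewrite (mem_Des labJ) Ji; split=> //.
by apply/exists_inP; exists J; case/andP: labJ; rewrite // eq_sym.
Qed.

Lemma Desbar_relE Mr : Mr \subset M ->
  Desbar_rel Mr M = [set J in Mr | [exists i, descent M J i]].
Proof.
move=> sMr; apply/setP => J; rewrite [LHS]inE [RHS]inE; apply: andb_id2l => JMr.
apply/exists_inP/existsP => -[i].
  have JM := subsetP sMr J JMr.
  rewrite Des_relE // inE => /exists_inP[A _ /descentP[Ai Ades]] Ji.
  have labJ : labeled M J i by rewrite /labeled JM.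
  by exists i; apply/descentP; rewrite -(labeled_unique M_ind Ai labJ).
move=> Ji; exists i; last by case/descentP: Ji => /andP[].
by rewrite Des_relE // inE; apply/exists_inP; exists J.
Qed.

End MaximumIndependentSet.

(** * Dependence on the trace on a component *)

Definition capped_component J : {set {set 'I_n}} :=
  cover (component G J) |: component G J.

Definition component_trace M J : {set {set 'I_n}} :=
  M :&: component G J :|: isolated G.

Lemma capped_component_refl J : J \in capped_component J.
Proof. by rewrite inE component_refl orbT. Qed.

Lemma cover_component_in_trace M J :
  J \in V -> cover (component G J) \in component_trace M J.
Proof. by move=> JV; rewrite inE cover_component_isolated ?orbT. Qed.

Section NonIsolated.

Variable J : {set 'I_n}.
Hypotheses (JV : J \in V) (J_not_isolated : J \notin isolated G).

Local Notation U := (cover (component G J)).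

Lemma proper_cover_component : J \proper U.
Proof.
rewrite properEneq sub_cover_component ?component_refl // andbT.
by apply: contraNneq J_not_isolated => ->; apply: cover_component_isolated.
Qed.

Lemma component_or_above K : K \in V -> J \proper K ->
  K \in component G J \/ U \subset K.
Proof.
move=> KV pJK; have [JK|nJK] := boolP (K \in component G J); [by left | right].
exact: cover_component_sub (proper_sub pJK).
Qed.

Lemma proper_capped_sub_component E K : E \in V -> E \notin component G J ->
    K \in capped_component J -> E \proper K ->
  exists F, [/\ F \in component G J, E \subset F & F \subset K].
Proof.
move=> EV nJE /setU1P[-> pEU|JK pEK]; last first.
  by exists K; rewrite (proper_sub pEK).
have [x xE] := connected_ideal_inhabited EV.
have /bigcupP[F JF xF] := subsetP (proper_sub pEU) x xE.
exists F; split=> //; last exact: sub_cover_component.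
case: (component_outside_nested JV JF EV nJE xF xE) => // sFE.
suff sUE : U \subset E by rewrite properE sUE andbF in pEU.
rewrite -(component_eq JF).
apply: cover_component_sub; rewrite ?(component_eq JF) //.
exact: component_vert JF.
Qed.

Lemma cover_component_proper E K : E \in V -> E \notin component G J ->
  K \in capped_component J -> E \proper K -> cover (component G E) \proper K.
Proof.
move=> EV nJE CK pEK.
have [F [JF sEF sFK]] := proper_capped_sub_component EV nJE CK pEK.
have FV : F \in V by apply: component_vert JF.
apply: proper_sub_trans sFK; rewrite properEneq cover_component_sub // ?andbT.
  apply: contraNneq (component_not_isolated J_not_isolated JF) => <-.
  exact: cover_component_isolated.
by rewrite component_sym (component_eq JF).
Qed.

Lemma child_capped_component S K : {subset S <= V} -> U \in S ->
  child S J K -> K \in capped_component J.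
Proof.
move=> sSV US /childP[_ KS pJK nobetween].
case: (component_or_above (sSV K KS) pJK) => [JK|].
  by rewrite inE JK orbT.
rewrite subEproper => /predU1P[<-|pUK]; first exact: setU11.
by have := nobetween U US proper_cover_component; rewrite pUK.
Qed.

Variable M : {set {set 'I_n}}.
Hypothesis M_max : maximum_independent G M.

Local Notation T := (component_trace M J).

Let sub_M_V : {subset M <= V}.
Proof. by case: M_max => -[/subsetP]. Qed.

Let sub_T_M : {subset T <= M}.
Proof. by apply/subsetP; rewrite subUset subsetIl isolated_sub_maximum. Qed.

Lemma mem_trace_capped K :
  K \in capped_component J -> (K \in T) = (K \in M).
Proof.
move=> CK; apply/idP/idP => [|KM]; first exact: sub_T_M.
case/setU1P: CK => [->|JK]; first exact: cover_component_in_trace.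
by rewrite in_setU in_setI KM JK.
Qed.

Lemma mu_trace K : K \in capped_component J -> mu M K = mu T K.
Proof.
move=> CK; apply/eqP; rewrite eqEsubset; apply/andP; split; last first.
  by apply/bigcupsP => E /andP[/sub_T_M EM pEK]; apply: sub_mu.
apply/bigcupsP => E /andP[EM pEK].
have [JE|nJE] := boolP (E \in component G J).
  by apply: sub_mu pEK; rewrite in_setU in_setI EM JE.
have EV := sub_M_V EM.
apply: subset_trans (sub_cover_component (component_refl G E)) (sub_mu _ _).
  by rewrite inE cover_component_isolated ?orbT.
exact: cover_component_proper.
Qed.

Lemma labeled_trace K i :
  K \in capped_component J -> labeled M K i = labeled T K i.
Proof. by move=> CK; rewrite /labeled mem_trace_capped // mu_trace. Qed.

Lemma child_trace K : child M J K = child T J K.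
Proof.
have UT := cover_component_in_trace M JV.
have CJ := capped_component_refl J.
apply/idP/idP => childK.
  have CK := child_capped_component sub_M_V (sub_T_M UT) childK.
  case/childP: childK => JM KM pJK nobetween; apply/childP.
  by split; rewrite ?mem_trace_capped // => L /sub_T_M; apply: nobetween.
have CK : K \in capped_component J.
  by apply: child_capped_component childK => // L /sub_T_M /sub_M_V.
case/childP: childK => JT KT pJK nobetween; apply/childP.
split; rewrite -?mem_trace_capped // => L LM pJL.
case: (component_or_above (sub_M_V LM) pJL) => [JL|sUL].
  by apply: nobetween; rewrite // mem_trace_capped // inE JL orbT.
have sKU : K \subset U by case/setU1P: CK => [->|/sub_cover_component].
by rewrite properE (subset_trans sKU sUL) andbF.
Qed.

Lemma descent_trace i : descent M J i = descent T J i.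
Proof.
have CJ := capped_component_refl J.
have capped K : child M J K -> K \in capped_component J.
  apply: child_capped_component sub_M_V _.
  exact/sub_T_M/cover_component_in_trace.
apply/descentP/descentP => -[Ji [K [j [JK Kj ji]]]].
  split; rewrite -?labeled_trace //; exists K, j.
  by rewrite -child_trace -labeled_trace // capped.
rewrite -child_trace in JK; split; rewrite ?labeled_trace //; exists K, j.
by rewrite labeled_trace ?capped.
Qed.

End NonIsolated.

Lemma descentE M J i : maximum_independent G M -> J \in V ->
  descent M J i = (J \notin isolated G) && descent (component_trace M J) J i.
Proof.
move=> M_max JV; have [J_iso|J_not_isolated] := boolP (J \in isolated G).
  by apply/negbTE/isolated_not_descent => //; case: M_max.
exact: descent_trace.
Qed.

End ConnectedIdeals.

Theorem theorem1p2 (n : nat) (le : rel 'I_n)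
    (le_po : partial_order le) (le_nat : naturally_labeled le)
    (C : {set {set 'I_n}}) (C_comp : C \in component_sets (ideal_graph le))
    (Mr : {set {set 'I_n}})
    (Mr_max : maximum_independent (induced (ideal_graph le) C) Mr)
    (M1 M2 : {set {set 'I_n}})
    (M1_max : maximum_independent (ideal_graph le) M1)
    (M2_max : maximum_independent (ideal_graph le) M2)
    (M1_Mr : M1 :&: C = Mr) (M2_Mr : M2 :&: C = Mr) :
  Des_rel Mr M1 = Des_rel Mr M2 /\ Desbar_rel Mr M1 = Desbar_rel Mr M2.
Proof.
have sMr1 : Mr \subset M1 by rewrite -M1_Mr subsetIl.
have sMr2 : Mr \subset M2 by rewrite -M2_Mr subsetIl.
have eq_descent J i : J \in Mr -> descent M1 J i = descent M2 J i.
  move=> JMr; have JV : J \in connected_ideals le.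
    by case: M1_max => -[/subsetP sM1 _] _; apply/sM1/(subsetP sMr1).
  have JC : J \in C by move: JMr; rewrite -M1_Mr => /setIP[].
  have eqC := component_setsE C_comp JC.
  rewrite (descentE le_po le_nat i M1_max JV).
  rewrite (descentE le_po le_nat i M2_max JV).
  by rewrite /component_trace -eqC M1_Mr M2_Mr.
split.
  rewrite (Des_relE le_po le_nat M1_max sMr1).
  rewrite (Des_relE le_po le_nat M2_max sMr2).
  apply/setP => i; rewrite [LHS]inE [RHS]inE.
  by apply: eq_existsb => J; apply: andb_id2l; apply: eq_descent.
rewrite (Desbar_relE le_po le_nat M1_max sMr1).
rewrite (Desbar_relE le_po le_nat M2_max sMr2).
apply/setP => J; rewrite [LHS]inE [RHS]inE.
by apply: andb_id2l => JMr; apply: eq_existsb => i; apply: eq_descent.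
Qed.
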